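(* $f(6) = 13$.
   Context: A hypergraph $\mathcal{H}$ consists of a vertex set $V(\mathcal{H})$ and a set $E(\mathcal{H})$ of edges, each a nonempty subset of $V(\mathcal{H})$. It is $r$-partite if $V(\mathcal{H})$ can be partitioned into $r$ parts such that every edge contains exactly one vertex from each part. It is intersecting if every two edges share at least one vertex. A cover of $\mathcal{H}$ is a set of vertices meeting every edge, and $\tau(\mathcal{H})$ is the minimum size of a cover. For $r \ge 2$, $f(r)$ denotes the minimum integer such that there exists an $r$-partite intersecting hypergraph $\mathcal{H}$ with $\tau(\mathcal{H}) = r-1$ and with exactly $f(r)$ edges. *)

(* Defs.v *)
From mathcomp Require Import all_boot.

Set Implicit Arguments.
Unset Strict Implicit.
Unset Printing Implicit Defensive.

Record hypergraph := Hypergraph {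
  vertex : finType;
  edges : {set {set vertex}};
  edges_nonempty : set0 \notin edges
}.

(* [partition] asks for nonempty parts; this only matters for hypergraphs
   without edges, since an edge has a vertex in every part. *)
Definition rpartite (r : nat) (H : hypergraph) : Prop :=
  exists P : {set {set vertex H}},
    [/\ partition P [set: vertex H], #|P| = r &
        forall e A, e \in edges H -> A \in P -> #|e :&: A| = 1].

Definition intersecting (H : hypergraph) : Prop :=
  forall e e', e \in edges H -> e' \in edges H -> e :&: e' != set0.

(* Unrelated to [finset.cover], which is the union of a set of sets. *)
Definition hcover (H : hypergraph) (C : {set vertex H}) : bool :=
  [forall e in edges H, e :&: C != set0].

Lemma hcoverT (H : hypergraph) : hcover [set: vertex H].
Proof.
apply/forall_inP => e eE; rewrite setIT.
by apply: contraNneq (edges_nonempty H) => <-.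
Qed.

(* The candidate [setT] is always a cover, by [hcoverT], so the arg min
   never falls back on its default value. *)
Definition tau (H : hypergraph) : nat :=
  #|[arg min_(C < [set: vertex H] | hcover C) #|C|]|.

Definition extremal (r n : nat) : Prop :=
  exists H : hypergraph,
    [/\ rpartite r H, intersecting H, tau H = r - 1 & #|edges H| = n].

(* The minimum need not be known to exist for every [r], so the equation
   f(r) = n is a relation: [n] is the least element of [extremal r]. *)
Definition f_eq (r n : nat) : Prop :=
  extremal r n /\ forall m, extremal r m -> n <= m.

(* Main.v *)
(* Upper bound: an explicit configuration with 13 edges, found by computer
   search, whose covers are excluded by exhaustion.

   Lower bound: view at most 12 edges as 12 points, possibly repeated, with six
   colourings such that any two points agree in some colouring; a vertex is a
   colour class. Points that remain can be covered two at a time, so if no four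
   classes cover, then k <= 4 classes cover at most 3 + 2k points. Counting
   pairs outside a class of size 5 excludes it. In each colouring the largest
   classes then have sizes at most 4, 3, 2, 2, 1, which account for
   6 + 3 + 1 + 1 = 11 pairs; since 6 * 11 = 66 is the number of pairs, each
   colouring has a class of size 4 and no pair agrees twice. The six classes of
   size 4 meet pairwise, but no three at one point as three classes cover at most
   9 points; so five of them mark distinct points of the sixth, which has four. *)
Require Import Defs.
From mathcomp Require Import all_boot zify.

Set Implicit Arguments.
Unset Strict Implicit.
Unset Printing Implicit Defensive.

(** * Minimum covers *)

Lemma tau_min (H : hypergraph) (C : {set vertex H}) : hcover C -> tau H <= #|C|.
Proof.
by rewrite /tau; case: arg_minnP => [|D _ minD]; [exact: hcoverT | exact: minD].
Qed.

Lemma tau_attained (H : hypergraph) :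
  exists2 C : {set vertex H}, hcover C & #|C| = tau H.
Proof.
by rewrite /tau; case: arg_minnP => [|D coverD _]; [exact: hcoverT | exists D].
Qed.

(** * The configuration with 13 edges *)

Definition example_table : seq (seq nat) :=
  [:: [:: 4; 4; 3; 1; 0; 1; 2; 2; 1; 0; 2; 1; 4];
      [:: 1; 3; 4; 0; 4; 2; 3; 1; 1; 1; 4; 4; 0];
      [:: 4; 1; 4; 1; 1; 0; 3; 1; 2; 0; 0; 3; 3];
      [:: 2; 1; 1; 3; 2; 2; 2; 0; 1; 4; 1; 0; 4];
      [:: 0; 3; 2; 2; 1; 3; 2; 4; 1; 2; 1; 0; 1];
      [:: 4; 2; 1; 4; 0; 1; 3; 1; 3; 2; 4; 2; 1]].

(** Rows are the six parts and columns the 13 edges: the entry tells which of the five vertices of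
    part [i] lies on edge [x]. *)
Definition colour (i x : nat) : nat := nth 0 (nth [::] example_table i) x.

(* A cover contains one of the six vertices of the first uncovered edge, so it
   suffices to branch on these. *)
Fixpoint no_cover (d : nat) (rem : seq nat) : bool :=
  if rem isn't x :: _ then false else
  if d isn't d'.+1 then true else
  all (fun i => no_cover d' [seq y <- rem | colour i y != colour i x]) (iota 0 6).

Definition example_vertex : finType := ('I_6 * 'I_5)%type.

Definition example_edge (x : nat) : {set example_vertex} :=
  [set v : 'I_6 * 'I_5 | colour v.1 x == v.2].

(** Induction on [d]: [C] has a vertex [v] on the first edge, and [C] without [v] must still meet
    every edge that avoids [v]. *)
Lemma no_coverP (d : nat) (rem : seq nat) (C : {set example_vertex}) :
  no_cover d rem -> {in rem, forall x, example_edge x :&: C != set0} -> d < #|C|.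
Proof.
elim: d rem C => [|d IHd] [|x rem] C // noC coverC.
  case/set0Pn: (coverC x (mem_head _ _)) => v /setIP[_ vC].
  by apply/card_gt0P; exists v.
case/set0Pn: (coverC x (mem_head _ _)) => v /setIP[xv vC].
rewrite (cardsD1 v) vC add1n ltnS.
have vP : (v.1 : nat) \in iota 0 6 by rewrite mem_iota /= ltn_ord.
have /allP/(_ _ vP) : all (fun i =>
    no_cover d [seq y <- x :: rem | colour i y != colour i x]) (iota 0 6) := noC.
rewrite /= eqxx => /IHd; apply=> y.
rewrite mem_filter => /andP[neq_yx y_rem].
have /coverC/set0Pn[w /setIP[yw wC]] : y \in x :: rem by rewrite inE y_rem orbT.
apply/set0Pn; exists w; rewrite inE yw in_setD1 wC andbT.
apply: contraNneq neq_yx => eq_wv; subst w.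
by move: xv yw; rewrite !inE => /eqP-> /eqP->.
Qed.

Lemma all_iota_ord (n : nat) (P : pred nat) :
  all P (iota 0 n) -> forall i : 'I_n, P i.
Proof. by move=> /allP allP i; apply: allP; rewrite mem_iota add0n ltn_ord. Qed.

Lemma example_edgeE (i : 'I_6) (x : 'I_13) :
  exists j : 'I_5, forall v : 'I_6 * 'I_5,
    (v \in example_edge x :&: [set w | w.1 == i]) = (v == (i, j)).
Proof.
have lt5 : colour i x < 5.
  have colours_lt : all (fun k => all (fun y => colour k y < 5) (iota 0 13)) (iota 0 6).
    by vm_compute.
  exact: all_iota_ord (all_iota_ord colours_lt i) x.
exists (Ordinal lt5) => -[k j]; rewrite !inE xpair_eqE andbC /=.
by case: eqP => //= ->; rewrite eq_sym.
Qed.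

Lemma example_edge_meet (x y : 'I_13) : example_edge x :&: example_edge y != set0.
Proof.
have meet : all (fun a => all (fun b =>
    has (fun k => colour k a == colour k b) (iota 0 6)) (iota 0 13)) (iota 0 13).
  by vm_compute.
have := all_iota_ord (all_iota_ord meet x) y.
case/hasP => k; rewrite mem_iota /= => lt_k6 /eqP eq_k.
have [j edgeE] := example_edgeE (Ordinal lt_k6) x.
have := edgeE (Ordinal lt_k6, j); rewrite eqxx !inE /= => /andP[/eqP xj _].
by apply/set0Pn; exists (Ordinal lt_k6, j); rewrite !inE /= -eq_k xj eqxx.
Qed.

(** Distinct columns of the table differ somewhere, so the edge set really has 13 members. *)
Lemma example_edge_inj : injective (fun x : 'I_13 => example_edge x).
Proof.
move=> x y /= eq_xy.
have sep : all (fun a => all (fun b =>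
    all (fun k => colour k a == colour k b) (iota 0 6) ==> (a == b))
    (iota 0 13)) (iota 0 13) by vm_compute.
apply/val_inj/eqP/(implyP (all_iota_ord (all_iota_ord sep x) y)).
apply/allP=> k; rewrite mem_iota /= => lt_k6.
have [j edgeE] := example_edgeE (Ordinal lt_k6) x.
have := edgeE (Ordinal lt_k6, j); rewrite eqxx => /setIP[xv _].
by move: (xv); rewrite eq_xy; move: xv; rewrite !inE /= => /eqP-> /eqP->.
Qed.

Definition example_edges : {set {set example_vertex}} :=
  [set example_edge x | x : 'I_13].

Lemma example_nonempty : set0 \notin example_edges.
Proof.
apply/imsetP => -[x _ edge0].
by have := example_edge_meet x x; rewrite -edge0 setIid eqxx.
Qed.

Definition example : hypergraph := Hypergraph example_nonempty.

Definition example_part (i : 'I_6) : {set example_vertex} :=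
  [set v : 'I_6 * 'I_5 | v.1 == i].

Lemma example_rpartite : rpartite 6 example.
Proof.
exists [set example_part i | i : 'I_6]; split.
- apply/and3P; split.
  + apply/eqP/setP => v; rewrite inE; apply/bigcupP; exists (example_part v.1).
      exact: imset_f.
    by rewrite inE.
  + apply/trivIsetP => _ _ /imsetP[i _ ->] /imsetP[k _ ->] neq_ik.
    rewrite disjoints_subset; apply/subsetP => v; rewrite !inE => /eqP vi.
    by apply: contraNneq neq_ik => vk; rewrite -vi -vk.
  + apply/imsetP => -[i _ /setP/(_ (i, ord0))].
    by rewrite !inE eqxx.
- rewrite card_imset ?card_ord // => i k /setP/(_ (i, ord0)).
  by rewrite !inE eqxx => /esym/eqP.
- move=> _ _ /imsetP[x _ ->] /imsetP[i _ ->].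
  have [j edgeE] := example_edgeE i x.
  by apply/eqP/cards1P; exists (i, j); apply/setP => v; rewrite edgeE inE.
Qed.

Lemma example_tau : tau example = 5.
Proof.
apply/eqP; rewrite eqn_leq; apply/andP; split.
  (* Any part is a cover, and each has five vertices. *)
  have cover0 : @hcover example (example_part ord0).
    apply/forall_inP => _ /imsetP[x _ ->].
    have [j edgeE] := example_edgeE ord0 x.
    by apply/set0Pn; exists (ord0, j); rewrite edgeE.
  apply: leq_trans (tau_min cover0) _.
  suff -> : example_part ord0 = setX [set ord0] setT.
    by rewrite cardsX cards1 cardsT card_ord.
  by apply/setP => v; rewrite !inE andbT.
have [C coverC <-] := tau_attained example.
have noC : no_cover 4 (iota 0 13) by vm_compute.
apply: (no_coverP noC) => x; rewrite mem_iota => lt_x13.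
have := forall_inP coverC (example_edge x); apply.
by apply/imsetP; exists (Ordinal lt_x13).
Qed.

Lemma extremal_6_13 : extremal 6 13.
Proof.
exists example; split.
- exact: example_rpartite.
- by move=> _ _ /imsetP[x _ ->] /imsetP[y _ ->]; apply: example_edge_meet.
- exact: example_tau.
- by rewrite card_imset ?card_ord //; apply: example_edge_inj.
Qed.

(** * Colour classes and counting of agreeing pairs *)

Section Colourings.

Variables (I E : finType) (T : eqType) (f : I -> E -> T).

Definition class (j : I) (x : E) : {set E} := [set y | f j y == f j x].

(** A class is named by a colouring and a representative point, so the classes listed in [s] are
    never empty. *)
Definition rest (s : seq (I * E)) : {set E} :=
  [set y | all (fun p => y \notin class p.1 p.2) s].

Lemma mem_class (j : I) (x : E) : x \in class j x.
Proof. by rewrite inE. Qed.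

Lemma class_eq (j : I) (x y : E) : y \in class j x -> class j y = class j x.
Proof. by rewrite inE => /eqP eq_f; apply/setP => z; rewrite !inE eq_f. Qed.

Lemma rest_nil : rest [::] = setT.
Proof. by apply/setP => y; rewrite !inE. Qed.

Lemma rest_cons (p : I * E) (s : seq (I * E)) :
  rest (p :: s) = rest s :\: class p.1 p.2.
Proof. by apply/setP => y; rewrite !inE /= inE. Qed.

Lemma rest_cat (s t : seq (I * E)) : rest (s ++ t) = rest s :&: rest t.
Proof. by apply/setP => y; rewrite !inE all_cat. Qed.

Hypothesis meet : forall x y, exists j, f j x = f j y.

(** By [meet], any two points left lie in a common class, so each further class removes two of
    them. *)
Lemma cover_by_pairs (k : nat) (R : {set E}) :
  #|R| <= k.*2 -> exists2 s, size s <= k & R :&: rest s = set0.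
Proof.
elim: k R => [|k IHk] R.
  by rewrite leqn0 cards_eq0 => /eqP->; exists [::]; rewrite ?set0I.
have [->|/set0Pn[x xR]] := eqVneq R set0; first by exists [::]; rewrite ?set0I.
rewrite (cardsD1 x) xR doubleS !ltnS.
have [Rx0 _|/set0Pn[y yR]] := eqVneq (R :\ x) set0.
  (* For a single point any colouring will do; [meet x x] supplies one. *)
  have [j _] := meet x x; exists [:: (j, x)] => //.
  apply/setP => z; rewrite rest_cons rest_nil setDE setTI !inE.
  apply/negP => /andP[zR neq]; move/setP/(_ z): Rx0; rewrite !inE zR andbT.
  by move/negbFE/eqP => eq_zx; move: neq; rewrite eq_zx eqxx /=.
rewrite (cardsD1 y) yR ltnS => /IHk[s size_s s_cover].
have [j eq_j] := meet x y; exists ((j, x) :: s) => //.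
apply/setP => z; rewrite rest_cons.
have /setP/(_ z) := s_cover; rewrite !inE.
case: (eqVneq z x) => [->|neq_zx]; first by rewrite eqxx /= ?andbF.
case: (eqVneq z y) => [->|neq_zy]; first by rewrite eq_j eqxx /= ?andbF.
by case: (z \in R) => //= ->; rewrite andbF.
Qed.

(** Remove a largest class from a union of classes. The conclusion reproduces the hypotheses with
    the removed size as the new [m], so iterating lists the sizes in decreasing order. *)
Lemma peel (j : I) (D : {set E}) (m : nat) :
    D != set0 -> {in D, forall x, class j x \subset D} ->
    {in D, forall x, #|class j x| <= m} ->
  exists a, let D' := D :\: class j a in
  [/\ #|class j a| <= m, {in D', forall x, class j x \subset D'},
      {in D', forall x, #|class j x| <= #|class j a|},
      #|D| = #|class j a| + #|D'| &
      \sum_(x in D) #|class j x| = #|class j a| ^ 2 + \sum_(x in D') #|class j x|].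
Proof.
case/set0Pn=> x0 x0D satD le_m.
case: (@arg_maxnP _ x0 (mem D) (fun x => #|class j x|) x0D) => a aD max_a.
have DI : D :&: class j a = class j a by apply/setIidPr/satD.
exists a; split=> //.
- exact: le_m.
- move=> x /setDP[xD xa]; rewrite subsetD satD //=.
  rewrite disjoint_sym disjoints_subset; apply/subsetP => y ya.
  rewrite inE; apply: contra xa => yx.
  by rewrite -(class_eq ya) (class_eq yx) mem_class.
- by move=> x /setDP[xD _]; apply: max_a.
- by rewrite -(cardsID (class j a) D) DI.
- rewrite (big_setID (class j a)) DI; congr (_ + _).
  rewrite (eq_bigr (fun=> #|class j a|)) ?sum_nat_const ?mulnn //.
  by move=> x /class_eq->.
Qed.

(** Double counting of triples of a colouring and two points of [R] that agree in it. *)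
Lemma sum_class_inter (R : {set E}) :
  \sum_j \sum_(x in R) #|class j x :&: R|
    = \sum_(x in R) \sum_(y in R) #|[set j | f j x == f j y]|.
Proof.
rewrite exchange_big; apply: eq_bigr => x _.
transitivity (\sum_j \sum_(y in R) (f j x == f j y)); last first.
  rewrite exchange_big; apply: eq_bigr => y _.
  by rewrite -sum1_card [RHS]big_mkcond; apply: eq_bigr => j _; rewrite inE; case: eqP.
apply: eq_bigr => j _; rewrite -sum1_card big_mkcond [RHS]big_mkcond.
by apply: eq_bigr => y _; rewrite !inE eq_sym; case: (y \in R); case: eqP.
Qed.

(** A point agrees with itself in all colourings and with any other point in at least one; equality
    holds when distinct points agree exactly once. *)
Lemma sum_class_inter_lower (R : {set E}) :
  #|R| * (#|I| + #|R|.-1) <= \sum_j \sum_(x in R) #|class j x :&: R|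
    ?= iff [forall (p | (p.1 \in R) && (p.2 \in R)),
             (if p.1 == p.2 then #|I| else 1) == #|[set j | f j p.1 == f j p.2]|].
Proof.
have -> : #|R| * (#|I| + #|R|.-1) =
    \sum_(p | (p.1 \in R) && (p.2 \in R)) (if p.1 == p.2 then #|I| else 1).
  rewrite -(pair_big (mem R) (mem R) (fun x y => if x == y then #|I| else 1)) /=.
  rewrite -sum_nat_const; apply: eq_bigr => x xR.
  rewrite (bigD1 x) //= eqxx (cardsD1 x) xR /= -[#|R :\ x|]sum1_card; congr (_ + _).
  rewrite add0n; apply: eq_big => [y|y /setD1P[neq_yx _]]; first by rewrite !inE andbC.
  by rewrite eq_sym (negPf neq_yx).
rewrite sum_class_inter pair_big /=; apply: leqif_sum => -[x y] _ /=.
apply: leqif_eq; case: eqP => [->|_]; last first.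
  by apply/card_gt0P; have [j eq_j] := meet x y; exists j; rewrite inE eq_j.
by rewrite -cardsT subset_leq_card //; apply/subsetP => j; rewrite !inE eqxx.
Qed.

Lemma sum_class_interT :
  \sum_i \sum_(x in [set: E]) #|class i x :&: setT| = \sum_i \sum_x #|class i x|.
Proof.
apply: eq_bigr => i _; apply: eq_big => [x|x _]; first by rewrite inE.
by rewrite setIT.
Qed.

Lemma linear_of_tight (x y : E) (j k : I) :
    \sum_i \sum_z #|class i z| <= #|E| * (#|I| + #|E|.-1) ->
  x != y -> j != k -> f j x = f j y -> f k x != f k y.
Proof.
move=> tight neq_xy neq_jk eq_j; apply/negP => /eqP eq_k.
have [lower eq_iff] := sum_class_inter_lower setT.
move: lower eq_iff; rewrite sum_class_interT cardsT => lower.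
rewrite eqn_leq lower tight => /esym/forall_inP/(_ (x, y)).
rewrite !inE (negPf neq_xy) => /(_ isT)/eqP card1.
have : #|[set j; k]| <= 1.
  rewrite card1 subset_leq_card //; apply/subsetP => i.
  by rewrite !inE => /orP[] /eqP->; rewrite ?eq_j ?eq_k eqxx.
by rewrite cards2 neq_jk.
Qed.

(** Here [a], [b], [c], [d] are the four largest class sizes, [e] counts the remaining points and
    [t] is their share of the sum of squares. The optimum 34 = 16 + 9 + 4 + 4 + 1 counts ordered
    pairs with the diagonal, that is 12 + 2 * 11. *)
Lemma square_sum_le (a b c d e t : nat) :
    a <= 4 -> b <= a -> c <= b -> d <= c -> a + b + c + d + e = 12 ->
    a + b <= 7 -> a + b + c <= 9 -> 0 < e -> t <= e * d -> t <= e * e ->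
  a ^ 2 + (b ^ 2 + (c ^ 2 + (d ^ 2 + t))) <= 34 /\
  (a ^ 2 + (b ^ 2 + (c ^ 2 + (d ^ 2 + t))) = 34 -> a = 4).
Proof.
rewrite -!mulnn => a4 ba cb dc total ab abc e0 t1 t2.
have eE : e = 12 - (a + b + c + d) by lia.
subst e; case: a a4 ba total ab abc e0 t1 t2 => [|[|[|[|[|a]]]]] //;
  case: b cb => [|[|[|[|[|b]]]]] //; case: c dc => [|[|[|[|[|c]]]]] //;
  case: d => [|[|[|[|[|d]]]]] //; lia.
Qed.

(** * Twelve points, six colourings and no cover by four classes *)

Section NoCover.

Hypothesis no_cover4 : forall s, size s <= 4 -> rest s != set0.

(** Otherwise [cover_by_pairs] would finish the cover with the [4 - size s] classes still
    available. *)
Lemma rest_gt (s : seq (I * E)) : size s <= 4 -> 2 * (4 - size s) < #|rest s|.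
Proof.
move=> size_s; rewrite ltnNge mul2n; apply/negP => /cover_by_pairs[t size_t t_cover].
suff : rest (s ++ t) != set0 by rewrite rest_cat t_cover eqxx.
by apply: no_cover4; rewrite size_cat; lia.
Qed.

Hypothesis card_E : #|E| = 12.
Hypothesis card_I : #|I| = 6.

Lemma card_rest1 (j : I) (x : E) : #|class j x| + #|rest [:: (j, x)]| = 12.
Proof. by rewrite rest_cons rest_nil setTD cardsC. Qed.

Lemma card_inter_rest_le2 (p : I * E) (j : I) (x : E) :
  5 <= #|class p.1 p.2| -> #|class j x :&: rest [:: p]| <= 2.
Proof.
move=> class_ge5; have := @rest_gt [:: (j, x); p] isT; rewrite rest_cons /=.
have := cardsID (class j x) (rest [:: p]); rewrite setIC.
by case: p class_ge5 => i y /= ; have := card_rest1 i y; lia.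
Qed.

Lemma class_le4 (j : I) (x : E) : #|class j x| <= 4.
Proof.
rewrite leqNgt; apply/negP => class_ge5; set R := rest [:: (j, x)].
have card_R : #|R| = 7.
  by have := @rest_gt [:: (j, x)] isT; have /= := card_rest1 j x; rewrite -/R; lia.
have le2 i y : #|class i y :&: R| <= 2 by apply: (@card_inter_rest_le2 (j, x)).
have [+ _] := sum_class_inter_lower R; rewrite card_R card_I.
(* Classes meet [R] in at most two points and 7 is odd, so some point contributes only 1. But 6 * 13
   = 78 is less than 7 * (6 + 6) = 84. *)
suff le13 i : \sum_(y in R) #|class i y :&: R| <= 13.
  have upper : \sum_i \sum_(y in R) #|class i y :&: R| <= 6 * 13.
    by rewrite -[X in X * _]card_I -sum_nat_const; apply: leq_sum => i _; apply: le13.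
  by move/leq_trans/(_ upper).
have [/forall_inP all2|] := boolP [forall y in R, #|class i y :&: R| == 2]; last first.
  rewrite negb_forall_in => /exists_inP[y yR neq2].
  have := cardsD1 y R; rewrite yR card_R => -[card_Ry].
  rewrite (big_setD1 y) //= (@leq_trans (1 + 6 * 2)) // leq_add //.
    by have := le2 i y; lia.
  by rewrite [in X in _ <= X]card_Ry -sum_nat_const leq_sum.
(* Seven elements do not split into classes of size two. *)
suff : 2 %| #|R| by rewrite card_R.
have /card_uniform_partition := preim_partitionP (f i) R.
move=> /(_ 2) ->; first by rewrite dvdn_mull.
move=> _ /imsetP[y yR ->]; rewrite -(eqP (all2 y yR)).
by apply: eq_card => z; rewrite !inE andbC eq_sym.
Qed.

Lemma sum_class_le (j : I) :
  \sum_x #|class j x| <= 34 /\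
  (\sum_x #|class j x| = 34 -> exists a, #|class j a| = 4).
Proof.
have satT : {in rest [::], forall x, class j x \subset rest [::]}.
  by move=> x _; rewrite rest_nil subsetT.
have nonempty s : size s <= 3 -> rest s != set0 by move=> ?; apply: no_cover4; lia.
have le4 : {in rest [::], forall x, #|class j x| <= 4} by move=> x _; apply: class_le4.
have [a] := peel (nonempty [::] isT) satT le4.
rewrite /= -(rest_cons (j, a)) => -[a4 sat1 le1 card1 sum1].
have [b] := peel (nonempty [:: (j, a)] isT) sat1 le1.
rewrite /= -(rest_cons (j, b)) => -[ba sat2 le2 card2 sum2].
have [c] := peel (nonempty [:: (j, b); (j, a)] isT) sat2 le2.
rewrite /= -(rest_cons (j, c)) => -[cb sat3 le3 card3 sum3].
have [d] := peel (nonempty [:: (j, c); (j, b); (j, a)] isT) sat3 le3.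
rewrite /= -(rest_cons (j, d)) => -[dc sat4 le4' card4 sum4].
(* One to four classes leave more than 6, 4, 2 and 0 points respectively. *)
have /= gt1 := @rest_gt [:: (j, a)] isT.
have /= gt2 := @rest_gt [:: (j, b); (j, a)] isT.
have /= gt3 := @rest_gt [:: (j, c); (j, b); (j, a)] isT.
have /= gt4 := @rest_gt [:: (j, d); (j, c); (j, b); (j, a)] isT.
set D4 := rest [:: (j, d), (j, c) & _] in sat4 le4' card4 sum4 gt4.
have tail1 : \sum_(x in D4) #|class j x| <= #|D4| * #|class j d|.
  by rewrite -sum_nat_const; apply: leq_sum.
have tail2 : \sum_(x in D4) #|class j x| <= #|D4| * #|D4|.
  by rewrite -sum_nat_const; apply: leq_sum => x /sat4/subset_leq_card.
have -> : \sum_x #|class j x| = \sum_(x in rest [::]) #|class j x|.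
  by apply: eq_bigl => x; rewrite rest_nil inE.
have total : #|rest [::]| = 12 by rewrite rest_nil cardsT.
suff [sum_le sum_eq] : \sum_(x in rest [::]) #|class j x| <= 34 /\
    (\sum_(x in rest [::]) #|class j x| = 34 -> #|class j a| = 4).
  by split=> // /sum_eq; exists a.
rewrite sum1 sum2 sum3 sum4.
by apply: (square_sum_le a4 ba cb dc _ _ _ _ tail1 tail2); lia.
Qed.

(** The six sums total at least 12 * (6 + 11) = 6 * 34, so none can fall below its maximum. *)
Lemma sum_class_eq (j : I) : \sum_x #|class j x| = 34.
Proof.
have [lower _] := sum_class_inter_lower setT.
rewrite sum_class_interT cardsT card_E card_I in lower.
have [le34 _] := sum_class_le j.
apply/eqP; rewrite eqn_leq le34 /= leqNgt; apply/negP => lt34.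
move: lower; rewrite (bigD1 j) //= leqNgt => /negP; apply.
have others : \sum_(i | i != j) \sum_x #|class i x| <= 5 * 34.
  have card_others : #|predC1 j| = 5 by rewrite cardC1 card_I.
  by rewrite -[X in X * _]card_others -sum_nat_const leq_sum // => i _; have [] := sum_class_le i.
by apply: leq_ltn_trans (leq_add (leqnn _) others) _; lia.
Qed.

Lemma linear (x y : E) (j k : I) : x != y -> j != k -> f j x = f j y -> f k x != f k y.
Proof.
apply: linear_of_tight; rewrite card_E card_I.
by under eq_bigr => i _ do rewrite sum_class_eq; rewrite sum_nat_const card_I.
Qed.

Lemma exists_class4 (j : I) : exists a, #|class j a| == 4.
Proof.
by have [_ /(_ (sum_class_eq j))[a class4]] := sum_class_le j; exists a; apply/eqP.
Qed.

Lemma no_cover_absurd : False.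
Proof.
pose a j := xchoose (exists_class4 j).
have class4 j : #|class j (a j)| = 4 by apply/eqP/(xchooseP (exists_class4 j)).
pose A j := class j (a j).
have linearA j k x y : j != k -> x \in A j :&: A k -> y \in A j :&: A k -> x = y.
  move=> neq_jk; rewrite !inE => /andP[/eqP xj /eqP xk] /andP[/eqP yj /eqP yk].
  apply/eqP/negPn/negP => neq_xy.
  by have /eqP := linear neq_xy neq_jk (etrans xj (esym yj)); rewrite xk yk.
have restU s : ~: rest s = \bigcup_(p <- s) class p.1 p.2.
  elim: s => [|p s IHs]; first by rewrite rest_nil setCT big_nil.
  by rewrite big_cons rest_cons setCD IHs setUC.
(* Two disjoint classes of size 4 would cover 8 points, but two classes cover at most 7. *)
have meetA j k : A j :&: A k != set0.
  apply/eqP => disj; have /= := @rest_gt [:: (j, a j); (k, a k)] isT.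
  have := cardsC (rest [:: (j, a j); (k, a k)]).
  rewrite restU !big_cons big_nil setU0 /= cardsU -/(A j) -/(A k) disj cards0 !class4 card_E.
  by lia.
have [j0 _] : exists j : I, true.
  by have : 0 < #|I| by [rewrite card_I]; case/card_gt0P => j; exists j.
(* The default [a j] is never reached, by [meetA]. *)
pose pt j := odflt (a j) [pick x in A j0 :&: A j].
have ptP j : pt j \in A j0 :&: A j.
  rewrite /pt; case: pickP => //= none; case/set0Pn: (meetA j0 j) => x.
  by rewrite none.
(* If [pt j = pt k], the three classes share that point and no two share another, so they cover 10
   points, more than 9. *)
have pt_inj : {in predC1 j0 &, injective pt}.
  move=> j k; rewrite !inE => neq_j neq_k eq_pt; apply/eqP/negPn/negP => neq_jk.
  have := @rest_gt [:: (j0, a j0); (j, a j); (k, a k)] isT.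
  have := cardsC (rest [:: (j0, a j0); (j, a j); (k, a k)]).
  rewrite restU !big_cons big_nil setU0 /= -/(A j0) -/(A j) -/(A k) card_E.
  have [neq_0j neq_0k] : j0 != j /\ j0 != k by split; rewrite eq_sym.
  have inter_le1 (B : {set E}) : {in B, forall x, x = pt j} -> #|B| <= 1.
    move=> Bpt; rewrite -(cards1 (pt j)) subset_leq_card //.
    by apply/subsetP => x /Bpt->; rewrite inE.
  have /setIP[pt0 ptj] := ptP j; have /setIP[_ ptk] := ptP k; rewrite -eq_pt in ptk.
  have jk_le1 : #|A j :&: A k| <= 1.
    by apply: inter_le1 => x xP; apply: (linearA j k); rewrite // inE ptj.
  have j0_le1 : #|A j0 :&: (A j :|: A k)| <= 1.
    apply: inter_le1 => x; rewrite setIUr => /setUP[xP|xP].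
      by apply: (linearA j0 j); rewrite // inE pt0.
    by apply: (linearA j0 k); rewrite // inE pt0.
  by rewrite !cardsU !class4 /=; lia.
have : #|pt @: predC1 j0| <= #|A j0|.
  by apply/subset_leq_card/subsetP => _ /imsetP[j _ ->]; have /setIP[] := ptP j.
by rewrite card_in_imset // cardC1 card_I class4.
Qed.

End NoCover.

End Colourings.

(** * From hypergraphs to colourings *)

Lemma extremal_6_ge13 (m : nat) : extremal 6 m -> 13 <= m.
Proof.
case=> H [[P [partP card_P edgeP]] interH tauH <-]; rewrite ltnNge; apply/negP => le12.
have [e0 e0H] : exists e0, e0 \in edges H.
  apply/set0Pn; apply/eqP => noE; suff /tau_min : @hcover H set0 by rewrite cards0 tauH.
  by apply/forall_inP => e; rewrite noE inE.
(* The default [e0] pads the list of edges to exactly 12 by repetition. *)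
pose e (x : 'I_12) := nth e0 (enum (edges H)) x.
have eH x : e x \in edges H.
  rewrite /e; have [lt|ge] := ltnP x (size (enum (edges H))); last by rewrite nth_default.
  by rewrite -mem_enum mem_nth.
have e_surj a : a \in edges H -> exists x, e x = a.
  rewrite -mem_enum => aE.
  have lt12 : index a (enum (edges H)) < 12.
    by rewrite (leq_trans _ le12) // cardE index_mem.
  by exists (Ordinal lt12); rewrite /e nth_index.
pose A (j : 'I_6) := enum_val (cast_ord (esym card_P) j).
pose f j x := e x :&: A j.
(* The colour of an edge in part [j] is the singleton of its vertex there, so agreeing in a colour
   means sharing a vertex. *)
have AP j : A j \in P by apply: enum_valP.
have f_card j x : #|f j x| = 1 by apply: edgeP.
have f_meet x y : exists j, f j x = f j y.
  have /set0Pn[v /setIP[vx vy]] := interH _ _ (eH x) (eH y).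
  have /and3P[/eqP coverP _ _] := partP.
  have /bigcupP[B BP vB] : v \in cover P by rewrite coverP inE.
  exists (cast_ord card_P (enum_rank_in BP B)).
  have fv z : v \in e z -> f (cast_ord card_P (enum_rank_in BP B)) z = [set v].
    move=> vz; apply/esym/eqP; rewrite eqEcard cards1 f_card andbT sub1set inE vz.
    by rewrite /A cast_ordK enum_rankK_in.
  by rewrite !fv.
apply: (no_cover_absurd f_meet _ (card_ord 12) (card_ord 6)) => s size_s.
apply/eqP => rest0.
(* Each class in [s] contributes its one vertex, so four covering classes would give a cover smaller
   than [tau H], which is 5. *)
pose C := \bigcup_(p <- s) f p.1 p.2.
have /tau_min : @hcover H C.
  apply/forall_inP => a /e_surj[x <-]; have := in_set0 x; rewrite -rest0 inE.
  move=> /negbT/allPn[p ps]; rewrite negbK inE => /eqP eq_f.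
  have /set0Pn[v vf] : f p.1 p.2 != set0 by rewrite -card_gt0 f_card.
  apply/set0Pn; exists v; move: (vf); rewrite -{1}eq_f => /setIP[vx _].
  by rewrite inE vx /C (big_rem p) //= inE vf.
rewrite tauH; apply/negP; rewrite -ltnNge ltnS (leq_trans _ size_s) // /C.
elim: s {rest0 size_s C} => [|p s IHs]; first by rewrite big_nil cards0.
by rewrite big_cons cardsU f_card (leq_trans (leq_subr _ _)) // add1n ltnS.
Qed.

Theorem theorem1 : f_eq 6 13.
Proof. by split; [exact: extremal_6_13 | exact: extremal_6_ge13]. Qed.
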